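(* Let $(G,\omega)$ be a connected pleasantly weighted finite multigraph, equipped with a ribbon structure, a vertex $q$, and an edge $e_0$ incident to $q$. Let $g=\sum_{e\in E}\omega(e)-\sum_{v\in V}\omega(v)+1$ be its weighted genus. Then \[\{D_{T,\sigma}: T \text{ a spanning tree for } G,\ \sigma \text{ an edge sub-weighting for } T\}\] forms a complete set of coset representatives for $\operatorname{Prin}(G)$ in $\operatorname{Div}^{g-1}(G)$, and \[\{D_{T,\sigma}: T \text{ a spanning tree for } G,\ \sigma \text{ a balanced edge sub-weighting for } T\}\] forms a complete set of coset representatives for $\operatorname{Prin}(G)$ in $\operatorname{Div}_b^{g-1}(G)$.
   Context: A weighted graph is a multigraph $G=(V,E)$ with a function $\omega:V\sqcup E\to\mathbb{Z}_{>0}$; it is pleasant (pleasantly weighted) if $\omega(v)\mid\omega(e)$ whenever $v$ is a vertex on the edge $e$. Divisors: $\operatorname{Div}(G)$ is the group of functions $D:V\to\mathbb{Z}$, written $\sum_v D(v)[v]$; $\deg D=\sum_v D(v)$; $\operatorname{Div}^d(G)$ is the set of divisors of degree $d$. $D$ is balanced if $\omega(v)\mid D(v)$ for all $v$; $\operatorname{Div}_b^d(G)$ is the set of balanced divisors of degree $d$. For $f:V\to\mathbb{Z}$ let $\Delta(f)=\sum_{v\in V}\Big(\sum_{e=\{v,w\}\in E}\omega(e)(f(v)-f(w))\Big)[v]$; $\operatorname{Prin}(G)$ is the image of $\Delta$. When $G$ is pleasant, $\operatorname{Prin}(G)\subseteq\operatorname{Div}_b^0(G)$. Ribbon structure: for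 each vertex, a cyclic ordering of the edges incident to it (a loop occurring twice). Orientation attached to a spanning tree $T$ (the ''tour'' of $T$): start with $(v,e):=(q,e_0)$ and repeat. If $e\notin T$: orient $e$ towards $v$ if $e$ has not been oriented yet, then replace $e$ by the next edge in the cyclic ordering around $v$. If $e\in T$: orient $e$ away from $v$ if $e$ has not been oriented yet, then replace $v$ by the other endpoint of $e$, and replace $e$ by the next edge after $e$ in the cyclic ordering around this new $v$. Eventually every edge of $G$ is oriented. Edge sub-weighting of a spanning tree $T=(V,E_T)$: a function $\sigma:E\to\mathbb{Z}$ with $\sigma(e)=\omega(e)$ for $e\notin E_T$ and $1\le\sigma(e)\le\omega(e)$ for $e\in E_T$. Using the orientation of $G$ attached to $T$, define \[D_{T,\sigma}=\sum_{e:w\to v\in E}\Big(\sigma(e)[v]+(\omega(e)-\sigma(e))[w]\Big)-\sum_{v\in V}\omega(v)[v]\in\operatorname{Div}^{g-1}(G),\] where $e:w\to v$ means that $e$ is oriented from $w$ to $v$. The sub-weighting $\sigma$ is a balanced edge sub-weighting for $T$ if $D_{T,\sigma}$ is a balanced divisor (for pleasant loopless $G$, equivalently $\omega(v)$ divides $\sum_{e\text{ to }v}\sigma(e)-\sum_{e\text{ from }v}\sigma(e)$ for all $v$). *)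

(* Defs.v *)
From HB Require Import structures.
From mathcomp Require Import all_boot all_order all_fingroup all_algebra.

Set Implicit Arguments.
Unset Strict Implicit.
Unset Printing Implicit Defensive.

Import GRing.Theory.
Local Open Scope ring_scope.

(* The endpoints of an edge e are endpt e false and endpt e true; e is a loop
   when they coincide. The labelling of the two ends is arbitrary bookkeeping
   and is not an orientation. *)
Record wgraph := WGraph {
  vert : finType;
  edge : finType;
  endpt : edge -> bool -> vert;
  vwt : vert -> nat;
  ewt : edge -> nat;
  vwt_gt0 : forall v, (0 < vwt v)%N;
  ewt_gt0 : forall e, (0 < ewt e)%N
}.

(* A dart is an edge together with one of its two ends, i.e. one occurrence
   of the edge around a vertex; a loop gives two darts at the same vertex. *)
Notation dart G := (edge G * bool)%type.

Definition base (G : wgraph) (d : dart G) : vert G := endpt d.1 d.2.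

Definition flip (G : wgraph) (d : dart G) : dart G := (d.1, ~~ d.2).

Definition pleasant (G : wgraph) : Prop :=
  forall d : dart G, (vwt (base d) %| ewt d.1)%N.

Definition adj (G : wgraph) (A : {set edge G}) : rel (vert G) :=
  [rel u v | [exists d : dart G,
     [&& d.1 \in A, base d == u & base (flip d) == v]]].

Definition connected (G : wgraph) (A : {set edge G}) : Prop :=
  forall u v : vert G, connect (adj A) u v.

(* A cycle is a nonempty closed walk, traversing each dart from its base to
   its other end, without repeated vertices or edges. A loop is a cycle of
   length 1 and two parallel edges form a cycle of length 2. *)
Definition is_cycle (G : wgraph) (c : seq (dart G)) : bool :=
  [&& c != [::],
      path.cycle [rel d d' | base (flip d) == base d'] c,
      uniq [seq base d | d <- c] &
      uniq [seq d.1 | d <- c]].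

Definition acyclic (G : wgraph) (A : {set edge G}) : Prop :=
  forall c : seq (dart G), is_cycle c -> ~~ all (fun d => d.1 \in A) c.

Definition spanning_tree (G : wgraph) (T : {set edge G}) : Prop :=
  connected T /\ acyclic T.

(* rot d is the dart following d in the cyclic ordering around base d. *)
Record ribbon (G : wgraph) := Ribbon {
  rot :> {perm dart G};
  rotP : forall d : dart G, porbit rot d = [set d' | base d' == base d]
}.

Section Divisors.
Variable G : wgraph.

Definition divisor := {ffun vert G -> int}.

Definition pt (v : vert G) : divisor := [ffun w => (w == v)%:R].

Definition deg (D : divisor) : int := \sum_v D v.

Definition balanced (D : divisor) : Prop :=
  forall v, ((vwt v)%:Z %| D v)%Z.

Definition Div_deg (d : int) (D : divisor) : Prop := deg D = d.

Definition Div_b_deg (d : int) (D : divisor) : Prop :=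
  deg D = d /\ balanced D.

(* Loops at v are summed twice here, but contribute 0. *)
Definition laplacian (f : vert G -> int) : divisor :=
  [ffun v => \sum_(d : dart G | base d == v)
                (ewt d.1)%:Z * (f v - f (base (flip d)))].

Definition Prin (D : divisor) : Prop := exists f, D = laplacian f.

Definition genus : int :=
  \sum_(e : edge G) (ewt e)%:Z - \sum_(v : vert G) (vwt v)%:Z + 1.

Definition coset_representatives (S X : divisor -> Prop) : Prop :=
  (forall D, S D -> X D) /\
  (forall D, X D -> exists! D', S D' /\ Prin (D - D')).

End Divisors.

Section Tour.
Variables (G : wgraph) (rho : ribbon G) (d0 : dart G) (T : {set edge G}).

(* ori e = Some b means that e is oriented from its end ~~ b towards its end b;
   ori e = None means that e has not been oriented yet. *)
Definition orientation := {ffun edge G -> option bool}.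

Definition orient (e : edge G) (b : bool) (ori : orientation) : orientation :=
  if ori e is Some _ then ori else [ffun e' => if e' == e then Some b else ori e'].

(* The current pair (v, e) is recorded as a dart on e based at v, so that the
   position in the cyclic ordering is determined even when e is a loop. *)
Definition tour_step (s : dart G * orientation) : dart G * orientation :=
  let: (d, ori) := s in
  if d.1 \in T then (rho (flip d), orient d.1 (~~ d.2) ori)
  else (rho d, orient d.1 d.2 ori).

Definition tour (n : nat) : dart G * orientation :=
  iter n tour_step (d0, [ffun=> None]).

(* The walk on darts is the iteration of a permutation, so no edge gets
   oriented after #|dart G| steps; see tour_stable. *)
Definition tour_orientation : orientation := (tour #|{: dart G}|).2.

Definition next_dart (d : dart G) : dart G :=
  if d.1 \in T then rho (flip d) else rho d.

Lemma next_dart_inj : injective next_dart.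
Proof.
rewrite /next_dart => -[e b] [e' b'] /=.
case: ifP => eT; case: ifP => eT' /perm_inj[] // ee bb; subst e'.
- by move/negb_inj: bb => ->.
- by rewrite eT in eT'.
- by rewrite eT in eT'.
- by rewrite bb.
Qed.

Lemma tour_dart n : (tour n).1 = iter n next_dart d0.
Proof.
elim: n => //= n <-; rewrite /tour_step /next_dart.
by case: (tour n) => d ori /=; case: ifP.
Qed.

Lemma tour_orientS n : exists b,
  (tour n.+1).2 = orient (iter n next_dart d0).1 b (tour n).2.
Proof.
rewrite -tour_dart /= /tour_step; case: (tour n) => d ori /=.
by case: ifP => _; [exists (~~ d.2) | exists d.2].
Qed.

Lemma tour_oriented k n : (k < n)%N -> (tour n).2 (iter k next_dart d0).1 != None.
Proof.
elim: n => // n IHn; rewrite ltnS leq_eqVlt => lekn.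
have [b ->] := tour_orientS n; rewrite /orient.
case E: ((tour n).2 (iter n next_dart d0).1) => [c|]; last first.
  rewrite ffunE; case: ifP => // /eqP kn; apply: IHn.
  by case/orP: lekn kn => // /eqP ->.
by case/orP: lekn => [/eqP -> | /IHn //]; rewrite E.
Qed.

Lemma tour_stable n : (#|{: dart G}| <= n)%N -> (tour n).2 = tour_orientation.
Proof.
elim: n => [|n IHn]; first by rewrite leqn0 /tour_orientation => /eqP ->.
rewrite leq_eqVlt => /orP[/eqP <- // | ]; rewrite ltnS => leNn.
rewrite -(IHn leNn); have [b ->] := tour_orientS n; rewrite /orient.
have: fconnect next_dart d0 (iter n next_dart d0) by apply: fconnect_iter.
move/iter_findex => E; have := findex_max (fconnect_iter next_dart n d0).
move=> ltk; have := @tour_oriented (findex next_dart d0 (iter n next_dart d0)) n.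
rewrite E => /(_ (leq_trans ltk (leq_trans (max_card _) leNn))).
by case: ((tour n).2 _).
Qed.

Definition sub_weighting (sigma : edge G -> int) : Prop :=
  (forall e, e \notin T -> sigma e = (ewt e)%:Z) /\
  (forall e, e \in T -> 1 <= sigma e <= (ewt e)%:Z).

(* The None branch never occurs for a spanning tree T, as the tour of T then
   orients every edge. *)
Definition tour_divisor (sigma : edge G -> int) : divisor G :=
  \sum_(e : edge G)
     (if tour_orientation e is Some b then
        pt (endpt e b) *~ sigma e
          + pt (endpt e (~~ b)) *~ ((ewt e)%:Z - sigma e)
      else 0)
  - \sum_(v : vert G) pt v *~ (vwt v)%:Z.

Definition balanced_sub_weighting (sigma : edge G -> int) : Prop :=
  sub_weighting sigma /\ balanced (tour_divisor sigma).

End Tour.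

(* Main.v *)
Require Import Defs.
From HB Require Import structures.
From mathcomp Require Import all_boot all_order all_fingroup all_algebra.
From mathcomp Require Import zify ring.

Set Implicit Arguments.
Unset Strict Implicit.
Unset Printing Implicit Defensive.

Import Order.TTheory GRing.Theory Num.Theory.
Local Open Scope ring_scope.

(** The vertex weights only translate all the divisors by a fixed one, so the
first claim is about the divisors [allocation ori sigma], in which every edge
splits its weight between its two ends as prescribed by the tour orientation
and by [sigma].  The proof characterizes them without mentioning trees: call a
divisor [D] of degree [\sum_e ewt e] [orientable] from [q] when every nonempty
vertex set [U] carries at least the weight of the edges inside [U], and one
unit more if [q] is not in [U].  The theorem then splits into three facts.

Each class contains exactly one orientable divisor.  If two of them differ by
[laplacian f], the vertices where [f] is maximal must send at least the whole
cut weight across their boundary, while orientability leaves room for strictly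
less ([orientable_unique]).  For existence ([equiv_orientable]), minimize over
[f] a quadratic energy whose linear term makes each inequality of
orientability the statement that lowering [f] by one on [U] does not decrease
the energy; the energy is bounded below because, in a connected graph, a
divisor of degree zero is the divergence of an integral flow ([exists_flow]).

Tour divisors are orientable ([tour_divisor_orientable]).  The tour of a
spanning tree runs through all the darts ([tour_visits_all]), so it enters
every nonempty [U] that avoids [q]; it enters for the first time along a tree
edge that was not oriented before, which thus points into [U] and gives [U] the
additional unit ([tour_enters]).

Every orientable divisor is a tour divisor ([orientable_tour_divisor]).  The
tree is built while touring.  At an edge that is still free, seen from its end
[v], one keeps it out of the tree and gives all its weight to [v] when every
set separating [v] from the other end [w] can afford it; otherwise [v] receives
as much as the tightest such set allows, [w] receives the positive remainder,
and the edge enters the tree.  Submodularity of the slack keeps all the sets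
affordable.  It also shows that [w] was not visited before, so that a tree is
built: the darts still to be toured form a stack, and for each vertex deeper
in the stack a set of zero slack separates it from the vertices above it,
which forces the first alternative for an edge leading back down the stack.

The balanced statement follows since, for pleasant weights, principal divisors
are balanced. *)

(** * Slack of a vertex set *)

Section Slack.
Variable G : wgraph.
Implicit Types (U M : {set vert G}) (e : edge G) (D : divisor G).
Implicit Types (l : edge G -> bool -> int) (f g : vert G -> int).

Definition crosses e U : bool := (endpt e true \in U) != (endpt e false \in U).

(** The number [l e b] is what the edge [e] has already promised to its end
[endpt e b].  An edge inside [U] counts with its full weight whatever it has
promised, since all of it must end up in [U]; this makes the promises of a
partial orientation and the bare graph ([unloaded]) instances of one notion. *)
Definition share l e U : int :=
  if (endpt e true \in U) && (endpt e false \in U) then (ewt e)%:Z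
  else l e true *+ (endpt e true \in U) + l e false *+ (endpt e false \in U).

Definition mass D U : int := \sum_(v in U) D v.

Definition ind U v : int := (v \in U)%:R.

Lemma sum_ind U f : \sum_(v in U) f v = \sum_v ind U v * f v.
Proof.
rewrite big_mkcond /=; apply: eq_bigr => v _; rewrite /ind.
by case: ifP; rewrite ?mul1r ?mul0r.
Qed.

Definition carried l U : int := \sum_e share l e U.

(** What [U] owns beyond the weight that the edges have to put into it; giving
a further promise to the vertices of [U] has to be paid from this. *)
Definition slack D l U : int := mass D U - carried l U.

Definition free_cut l U : int :=
  \sum_e ((ewt e)%:Z - l e true - l e false) *+ crosses e U.

Definition unloaded : edge G -> bool -> int := fun _ _ => 0.

Definition total_weight : int := \sum_(e : edge G) (ewt e)%:Z.

(** The divisors of fractional orientations of the edges in which every vertex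
is reachable from [q]. *)
Definition orientable q D : Prop :=
  deg D = total_weight /\
  forall U, U != set0 -> (q \notin U)%:R <= slack D unloaded U.

Lemma slack_setT D l : deg D = total_weight -> slack D l setT = 0.
Proof.
move=> degD; apply/eqP; rewrite subr_eq0 /mass (eq_bigl xpredT) => [|v]; last first.
  by rewrite inE.
rewrite -/(deg D) degD; apply/eqP/eq_bigr => e _.
by rewrite /share !inE.
Qed.

(** An edge joining [U] to [M] across their differences lies inside the union
only, where it counts in full; hence the gain by its unpromised weight. *)
Lemma slack_submodular D l U M :
  (forall e b, 0 <= l e b) -> (forall e, l e true + l e false <= (ewt e)%:Z) ->
  forall e b, endpt e b \in U -> endpt e b \notin M ->
    endpt e (~~ b) \in M -> endpt e (~~ b) \notin U ->
  slack D l (U :|: M) + slack D l (U :&: M)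
    + ((ewt e)%:Z - l e true - l e false) <= slack D l U + slack D l M.
Proof.
move=> l0 lw e b eU eM e'M e'U.
have divE : mass D (U :|: M) + mass D (U :&: M) = mass D U + mass D M.
  rewrite /mass !sum_ind -!big_split /=; apply: eq_bigr => v _; rewrite /ind !inE.
  by case: (v \in U); case: (v \in M); rewrite /=; ring.
have loc e' : share l e' U + share l e' M <=
              share l e' (U :|: M) + share l e' (U :&: M).
  rewrite /share !inE; have := l0 e' true; have := l0 e' false; have := lw e'.
  by case: (_ \in U); case: (_ \in M); case: (_ \in U); case: (_ \in M);
    rewrite /= ?mulr0n ?mulr1n; lia.
have loce : share l e U + share l e M + ((ewt e)%:Z - l e true - l e false) =
              share l e (U :|: M) + share l e (U :&: M).
  rewrite /share !inE; case: b eU eM e'M e'U => /= -> /negbTE-> -> /negbTE->;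
    by rewrite /= ?mulr0n ?mulr1n; ring.
have : carried l U + carried l M + ((ewt e)%:Z - l e true - l e false)
   <= carried l (U :|: M) + carried l (U :&: M).
  rewrite /carried -!big_split (bigD1 e) //= [leRHS](bigD1 e) //=.
  rewrite (addrAC (_ + _)) loce.
  by apply: lerD => //; apply: ler_sum => e1 _; exact: loc.
rewrite /slack; lia.
Qed.

(** Only edges across the cut are counted differently by a set and its
complement together than by the whole vertex set, which has no slack. *)
Lemma slack_setC D l U : deg D = total_weight ->
  slack D l U + slack D l (~: U) = free_cut l U.
Proof.
move=> degD; have := slack_setT l degD; rewrite /slack => sT.
have divE : mass D U + mass D (~: U) = mass D setT.
  rewrite /mass !sum_ind -!big_split /=; apply: eq_bigr => v _; rewrite /ind !inE.
  by case: (v \in U); rewrite /=; ring.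
have : carried l setT = carried l U + carried l (~: U)
   + free_cut l U.
  rewrite /carried -!big_split /=; apply: eq_bigr => e _; rewrite /share /crosses !inE.
  by case: (_ \in U); case: (_ \in U); rewrite /= ?mulr0n ?mulr1n; ring.
lia.
Qed.

Lemma sum_darts (F : dart G -> int) :
  \sum_d F d = \sum_e (F (e, true) + F (e, false)).
Proof.
transitivity (\sum_e \sum_b F (e, b)); last first.
  by apply: eq_bigr => e _; rewrite big_bool.
by rewrite pair_bigA; apply: eq_bigr => -[].
Qed.

Definition grad f e : int := f (endpt e true) - f (endpt e false).

Lemma pairing_laplacian g f :
  \sum_v g v * laplacian f v = \sum_e (ewt e)%:Z * grad g e * grad f e.
Proof.
transitivity (\sum_(d : dart G) g (base d) *
    ((ewt d.1)%:Z * (f (base d) - f (base (flip d))))).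
  rewrite (partition_big (@base G) xpredT) //=; apply: eq_bigr => v _.
  rewrite ffunE big_distrr /=; apply: eq_bigr => d /eqP ->; by [].
rewrite sum_darts; apply: eq_bigr => e _.
by rewrite /grad /base /flip /=; ring.
Qed.

Lemma massB D D' U : mass (D - D') U = mass D U - mass D' U.
Proof. by rewrite /mass -sumrB; apply: eq_bigr => v _; rewrite !ffunE. Qed.

Lemma degB D D' : deg (D - D') = deg D - deg D'.
Proof. by rewrite /deg -sumrB; apply: eq_bigr => v _; rewrite !ffunE. Qed.

Lemma deg_laplacian f : deg (laplacian f) = 0.
Proof.
transitivity (\sum_v (fun=> 1) v * laplacian f v).
  by apply: eq_bigr => v _; rewrite mul1r.
rewrite pairing_laplacian big1 // => e _.
by rewrite /grad subrr mulr0 mul0r.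
Qed.

(** * One orientable divisor in each class *)

(** With [D - D'] the Laplacian of [f], look at the set [M] where [f] is
maximal.  The mass of [D - D'] on [M] is at least the weight of the cut around
[M]; by [slack_setC] it is at most that weight minus the extra unit that
orientability grants to whichever of [M] and its complement avoids [q]. *)
Lemma orientable_unique q D D' :
  orientable q D -> orientable q D' -> Prin (D - D') -> D = D'.
Proof.
move=> [degD oD] [degD' oD'] [f DD']; apply/eqP; rewrite -subr_eq0 DD'.
pose top := [arg max_(v > q) f v]%O.
have topP v : f v <= f top by rewrite /top; case: arg_maxP => //= i _; exact.
pose M := [set v | f v == f top].
have topM : top \in M by rewrite inE.
have M0 : M != set0 by apply/set0Pn; exists top.
have := eqVneq (~: M) set0 => -[/setP MT|MC0].
  apply/eqP/ffunP => v; rewrite !ffunE big1 // => d _.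
  have fE w : f w = f top by have := MT w; rewrite !inE => /negbFE/eqP.
  by rewrite !fE subrr mulr0.
have LM : mass (D - D') M
          = \sum_e (ewt e)%:Z * grad (ind M) e * grad f e.
  by rewrite DD' /mass sum_ind pairing_laplacian.
have LMge : free_cut unloaded M <= mass (D - D') M.
  rewrite LM; apply: ler_sum => e _; rewrite /crosses /grad /ind !inE.
  have := topP (endpt e true); have := topP (endpt e false).
  rewrite /unloaded !subr0.
  case: (eqVneq (f (endpt e true)) (f top)) => [->|n1];
  case: (eqVneq (f (endpt e false)) (f top)) => [->|n2] //= *;
    rewrite ?mulr1n ?mulr0n /=; nia.
have DM : mass (D - D') M = slack D unloaded M - slack D' unloaded M.
  by rewrite massB /slack; ring.
have := slack_setC unloaded M degD.
have := oD _ MC0; have := oD' _ M0; rewrite in_setC negbK => o1 o2 o3.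
exfalso; move: o1 o2 o3 LMge DM.
by case: (q \in M); rewrite /= ?mulr0n ?mulr1n; lia.
Qed.

(** In a connected graph a divisor of degree zero is the divergence of an
integral flow: [f v - f u] telescopes along a path from [u] to [v]. *)
Lemma exists_flow (B : vert G -> int) : connected [set: edge G] ->
  \sum_v B v = 0 ->
  exists h : edge G -> int, forall f, \sum_v B v * f v = \sum_e h e * grad f e.
Proof.
move=> conn B0.
have step u v : exists h : edge G -> int,
    forall f, f v - f u = \sum_e h e * grad f e.
  have /connectP[p] := conn u v; elim: p u => [|w p IHp] u /=.
    move=> _ ->; exists (fun=> 0) => f; rewrite subrr big1 // => e _.
    by rewrite mul0r.
  case/andP=> /existsP[[e b]] /and3P[_ /eqP eu /eqP ew] pth lst.
  have [h hP] := IHp _ pth lst.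
  exists (fun e' => h e' + (-1) ^+ b *+ (e' == e)) => f.
  rewrite (_ : f v - f u = f v - f w + (f w - f u)); last by ring.
  rewrite hP.
  transitivity (\sum_e' (h e' * grad f e'
      + ((-1) ^+ b *+ (e' == e)) * grad f e')); last first.
    by apply: eq_bigr => e' _; rewrite mulrDl.
  rewrite big_split /=; congr (_ + _).
  rewrite (bigD1 e) //= eqxx mulr1n big1 => [|e' /negbTE->]; last first.
    by rewrite mulr0n mul0r.
  rewrite addr0 -eu -ew /base /flip /grad /=.
  by case: (b); rewrite /= ?expr1 ?expr0; ring.
have [q _|V0] := pickP (mem [set: vert G]); last first.
  exists (fun=> 0) => f; rewrite !big1 // => [e _|v _]; first by rewrite mul0r.
  by have := V0 v; rewrite !inE.
have [h hP] := fin_all_exists (step q).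
exists (fun e => \sum_v B v * h v e) => f.
transitivity (\sum_v B v * (f v - f q)).
  under [RHS]eq_bigr => v _ do rewrite mulrBr.
  by rewrite sumrB -big_distrl /= B0 mul0r subr0.
under eq_bigr => v _ do rewrite hP big_distrr /=.
rewrite exchange_big /=; apply: eq_bigr => e _; rewrite big_distrl /=.
by apply: eq_bigr => v _; rewrite mulrA.
Qed.

(** Minimize the energy [E f], where the quadratic term is the Laplacian form.
The effect on [E] of lowering [f] by one on [U] is [2 * N] times the slack of
[U] in [D - laplacian f], up to a term that is at most [2 * N] in absolute
value and carries the strict inequality for the sets avoiding [q]. *)
Lemma equiv_orientable q D : connected [set: edge G] ->
  deg D = total_weight -> exists f, orientable q (D - laplacian f).
Proof.
move=> conn degD.
pose N : int := #|vert G|%:Z.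
have N1 : 1 <= N by rewrite /N lez_nat; apply/card_gt0P; exists q.
(* B is 2 N times the divisor D - c - p / N, where c v is half the total
   edge weight around v and p = \sum_v [v] - N [q].  The mass of c on U is the
   weight inside U plus half the cut; the perturbation p makes the inequalities
   strict for U avoiding q and costs less than one unit for U containing q. *)
pose B v : int := 2 * N * D v
  - N * (\sum_(d : dart G | base d == v) (ewt d.1)%:Z)
  - 2 * (1 - N *+ (v == q)).
have Bf g : \sum_v g v * B v = 2 * N * (\sum_v g v * D v)
   - N * (\sum_e (ewt e)%:Z * (g (endpt e true) + g (endpt e false)))
   - 2 * (\sum_v g v - N * g q).
  have -> : \sum_e (ewt e)%:Z * (g (endpt e true) + g (endpt e false))
         = \sum_v g v * \sum_(d : dart G | base d == v) (ewt d.1)%:Z.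
    transitivity (\sum_(d : dart G) g (base d) * (ewt d.1)%:Z).
      by rewrite sum_darts; apply: eq_bigr => e _; rewrite /base /=; ring.
    rewrite (partition_big (@base G) xpredT) //=; apply: eq_bigr => v _.
    by rewrite big_distrr /=; apply: eq_bigr => d /eqP ->.
  have -> : N * g q = \sum_v g v * (N *+ (v == q)).
    rewrite (bigD1 q) //= eqxx big1 => [|v /negbTE->]; last by rewrite mulr0.
    by rewrite addr0 mulrC.
  rewrite -sumrB 3!big_distrr -!sumrB /=; apply: eq_bigr => v _.
  by rewrite /B; ring.
have B0 : \sum_v B v = 0.
  transitivity (\sum_v (fun=> 1) v * B v).
    by apply: eq_bigr => v _; rewrite mul1r.
  rewrite Bf sumr_const; under eq_bigr => v _ do rewrite mul1r.
  rewrite -/(deg D) degD -big_distrl /= -/total_weight /N.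
  ring.
have [h hP] := exists_flow conn B0.
pose E f : int := N * (\sum_e (ewt e)%:Z * grad f e * grad f e) - \sum_v f v * B v.
pose C : int := \sum_e h e ^+ 2.
(* Edge by edge, N w x^2 - h x + h^2 >= x^2 - h x + h^2 >= 0. *)
have Ebound f : 0 <= E f + C.
  rewrite /E /C; under [X in _ - X]eq_bigr => v _ do rewrite mulrC.
  rewrite hP big_distrr -sumrB -big_split /=; apply: sumr_ge0 => e _.
  have := ewt_gt0 e; rewrite -mulrA mulrA -ltz_nat.
  move: (grad f e) (h e) (ewt e)%:Z => x y w w0.
  have : x * x <= N * w * (x * x) by rewrite ler_peMl -?expr2 ?sqr_ge0; nia.
  nia.
pose stable f := [forall U : {set vert G}, E f <= E (fun v => f v - ind U v)].
have [f fP] : exists f, stable f.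
  suff : forall n f, E f + C <= n%:Z -> exists f, stable f.
    by move=> /(_ `|(E (fun=> 0) + C)%R|%N (fun=> 0)); apply; rewrite gez0_abs.
  elim=> [|n IHn] f fn; case: (boolP (stable f)) => [|/forallPn[U]];
    try by exists f.
    by rewrite -ltNge => lt; have := Ebound (fun v => f v - ind U v); lia.
  by rewrite -ltNge => lt; apply: (IHn (fun v => f v - ind U v)); lia.
exists f; split.
  by rewrite degB deg_laplacian subr0.
move=> U U0.
have /forallP/(_ U) := fP; rewrite /E.
have ge : mass (laplacian f) U = \sum_e (ewt e)%:Z * grad (ind U) e * grad f e.
  by rewrite /mass sum_ind pairing_laplacian.
have gg : \sum_e (ewt e)%:Z * grad (ind U) e * grad (ind U) e
          = free_cut unloaded U.
  apply: eq_bigr => e _; rewrite /grad /ind /crosses /unloaded !subr0.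
  by case: (_ \in U); case: (_ \in U); rewrite /= ?mulr1n ?mulr0n; ring.
have -> : \sum_e (ewt e)%:Z * grad (fun v => f v - ind U v) e
                    * grad (fun v => f v - ind U v) e
    = \sum_e (ewt e)%:Z * grad f e * grad f e - 2 * mass (laplacian f) U
       + free_cut unloaded U.
  rewrite -gg ge big_distrr -sumrB -big_split /=; apply: eq_bigr => e _.
  by rewrite /grad; ring.
have -> : \sum_v (f v - ind U v) * B v = \sum_v f v * B v - \sum_v ind U v * B v.
  by rewrite -sumrB; apply: eq_bigr => v _; rewrite mulrBl.
have -> : \sum_v ind U v * B v = 2 * N * mass D U
    - N * (2 * carried unloaded U + free_cut unloaded U) - 2 * (#|U|%:Z - N * ind U q).
  rewrite Bf /mass [in RHS]sum_ind; congr (_ - _ * _ - 2 * (_ - _)).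
    rewrite /carried /free_cut big_distrr -big_split /=; apply: eq_bigr => e _.
    rewrite /share /crosses /ind /unloaded.
    by case: (_ \in U); case: (_ \in U); rewrite /= ?mulr1n ?mulr0n; ring.
  rewrite -[RHS]natz -sumr_const [RHS]sum_ind.
  by apply: eq_bigr => v _; rewrite mulr1.
rewrite /slack massB /ind.
have : 0 < #|U|%:Z by rewrite ltz_nat card_gt0.
move: (free_cut _ U) (carried _ U) (\sum_e _) (\sum_v _) => c k s1 s2.
move: (mass D U) (mass _ U) #|U|%:Z => d l u u0 H.
have {}H : N * (q \in U)%:R + N * (d - l - k) >= u by nia.
have : 0 < (q \in U)%:R + (d - l - k) by nia.
by case: (q \in U); rewrite /= ?mulr1n ?mulr0n; lia.
Qed.
End Slack.

(** * Rotation around vertices and non-backtracking walks *)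

Section Rotation.
Variables (G : wgraph).
Implicit Types (d x y : dart G).

Lemma flipK : involutive (@flip G).
Proof. by case=> e b; rewrite /flip /= negbK. Qed.

Lemma flip_neq d : flip d != d.
Proof. by case: d => e []; apply/eqP => -[]. Qed.

Lemma same_edge d d' : d.1 = d'.1 -> d' = d \/ d' = flip d.
Proof. by case: d d' => e [] [e' []] /= <-; [left|right|right|left]. Qed.

Lemma base_rot (rho : ribbon G) d : base (rho d) = base d.
Proof.
have := mem_porbit rho 1 d; rewrite rotP inE expg1.
by move/eqP.
Qed.

Lemma rot_reach (rho : ribbon G) d d' : base d = base d' ->
  exists i, d' = iter i rho d.
Proof.
move=> dd'; have : d' \in porbit rho d by rewrite rotP inE dd'.
by case/porbitP=> i ->; exists i; rewrite permX.
Qed.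

Lemma uniq_map_inj (T1 T2 : eqType) (f : T1 -> T2) (s : seq T1) :
  uniq (map f s) -> {in s &, injective f}.
Proof.
elim: s => //= z s IHs /andP[zs us] x y.
rewrite !inE => /orP[/eqP->|xs] /orP[/eqP->|ys] // E; last exact: IHs.
- by rewrite E map_f in zs.
- by rewrite -E map_f in zs.
Qed.

(** Follow the given continuation from [x] until a vertex repeats; the walk
between the two visits is a cycle.  Its edges are distinct: a repeated edge
would be traversed in both directions, and as the vertices do not repeat, the
two traversals would be consecutive, which non-backtracking excludes. *)
Lemma nonbacktracking_cycle (S : {set dart G}) x : x \in S ->
  (forall d, d \in S ->
     exists d', [/\ d' \in S, base d' = base (flip d) & d' != flip d]) ->
  exists2 c, is_cycle c & {subset c <= S}.
Proof.
move=> xS next.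
have /fin_all_exists[phi phiP] : forall d, exists d', d \in S ->
    [/\ d' \in S, base d' = base (flip d) & d' != flip d].
  move=> d; case: (boolP (d \in S)) => [/next[d' d'P]|_]; last by exists d.
  by exists d'.
have walkS i : iter i phi x \in S.
  by elim: i => //= i /phiP[].
have : exists n, ~~ uniq [seq base d | d <- traject phi x n].
  exists #|vert G|.+1; apply/negP => /card_uniqP; rewrite size_map size_traject.
  by move=> card; have := max_card (mem [seq base d | d <- traject phi x #|vert G|.+1]);
    rewrite card ltnn.
move/ex_minnP=> [[|k] // Nk kmin].
have uk : uniq [seq base d | d <- traject phi x k].
  by apply/negPn/negP => /kmin; rewrite ltnn.
move: Nk; rewrite trajectSr map_rcons rcons_uniq uk andbT negbK.
(* k is the first step at which a vertex repeats, i the step repeated. *)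
case/mapP=> y /trajectP[i ik ->{y}] close.
have kE : k = (i + (k - i.+1).+1)%N by lia.
move: (k - i.+1)%N kE => n kE; move: uk; rewrite kE trajectD map_cat.
rewrite cat_uniq => /and3P[_ _]; move: close; rewrite kE addnC iterD.
have: iter i phi x \in S := walkS i.
move: (iter i phi x) => y yS close ub.
have itS j : iter j phi y \in S by elim: j => //= j /phiP[].
set c := traject phi y n.+1.
have cS : {subset c <= S} by move=> d /trajectP[j _ ->].
have binj : {in c &, injective (@base G)} by apply: uniq_map_inj.
have stay d : d \in c -> phi d \in c \/ d = iter n phi y.
  case/trajectP=> j; rewrite ltnS leq_eqVlt => /orP[/eqP->|jn ->]; first by right.
  by left; apply/trajectP; exists j.+1.
have noflip d : phi d \in c -> flip d \in c -> d \in S -> False.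
  move=> pc fc /phiP[_ bp]; case/negP; apply/eqP; exact: binj.
exists c => //; apply/and4P; split=> //; last first.
  rewrite map_inj_in_uniq ?(map_uniq ub) // => d d' dc d'c /same_edge[] // dd'.
  case: (stay d dc) (stay d' d'c) => [pd|->]; last case=> [pd'|//].
    by exfalso; apply: (noflip d); rewrite -?dd' //; exact: cS.
  by exfalso; apply: (noflip d'); rewrite ?dd' ?flipK -?dd' //; exact: cS.
rewrite /= rcons_path last_traject; apply/andP; split.
    apply: (@sub_in_path _ (mem S) _ _ _ _ _ _ (fpath_traject phi y n)).
      by move=> d d' /phiP[_ bp _] _ /= /eqP<-; rewrite bp.
    by apply/allP => d; exact: cS.
  by have /phiP[_ /= <- _] := itS n; rewrite -iterS close.
Qed.
End Rotation.

(** * The tour of a spanning tree *)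

Section Visit.
Variables (G : wgraph) (rho : ribbon G) (d0 : dart G) (T : {set edge G}).
Hypothesis treeT : spanning_tree T.
Let next := next_dart rho T.

(** Let [O] be the set of darts on the tour.  Rotating around a vertex changes
membership in [O] exactly at the split darts, those on a tree edge with only
one of its two darts in [O].  A cyclic sequence does not change just once, so
no vertex has exactly one split dart, and split edges would contain a cycle of
the tree.  Hence [O] is closed under rotation and under flipping tree darts,
and connectedness makes it everything. *)
Lemma tour_visits_all d : fconnect next d0 d.
Proof.
pose O := [set d | fconnect next d0 d].
have Onext x : (next x \in O) = (x \in O).
  by rewrite !inE -same_fconnect1_r //; apply: next_dart_inj.
pose split x := (x.1 \in T) && ((x \in O) != (flip x \in O)).
have Orot x : ~~ split x -> (rho x \in O) = (x \in O).
  rewrite /split negb_and negbK; case xT: (x.1 \in T); rewrite /= => xf.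
    move/eqP: xf => xf.
    by rewrite xf -(Onext (flip x)) /next /next_dart /= xT flipK.
  by rewrite -(Onext x) /next /next_dart xT.
have other x : split x -> exists y, [/\ split y, base y = base x & y != x].
  move=> sx.
  case: (pickP [pred y | [&& split y, base y == base x & y != x]]) => [y|none].
    by case/and3P=> sy /eqP bx yx; exists y.
  have only y : base y = base x -> y != x -> ~~ split y.
    by move=> yx nyx; have := none y; rewrite /= yx eqxx nyx /= andbT => ->.
  have Oconst i : (iter i rho (rho x) \in O) = (rho x \in O).
    elim: i => //= i IHi; rewrite -IHi.
    have [E|ne] := eqVneq (iter i rho (rho x)) x; first by rewrite IHi E.
    apply/Orot/only => //; elim: (i) => [|j /=]; rewrite /= base_rot //.
  have [i xi] : exists i, x = iter i rho (rho x).
    by apply: rot_reach; rewrite base_rot.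
  have := Oconst i; rewrite -xi => Ox; move: sx; rewrite /split => /andP[xT].
  by rewrite Ox -(Onext (flip x)) /next /next_dart /= xT flipK eqxx.
have nosplit x : ~~ split x.
  apply/negP => sx; have [_ acT] := treeT.
  have [||c cyc cS] := @nonbacktracking_cycle G [set y | split y] x.
  - by rewrite inE.
  - move=> y; rewrite inE => /andP[yT yO].
    have [|z [sz bz nz]] := other (flip y).
      by rewrite /split /= yT flipK eq_sym.
    by exists z; rewrite inE.
  - have /negP[] := acT c cyc; apply/allP => y /cS.
    by rewrite inE => /andP[].
have around x y : base x = base y -> x \in O -> y \in O.
  case/(rot_reach rho)=> i ->; elim: i => //= i IHi xO.
  by rewrite Orot ?IHi.
have d0O : d0 \in O by rewrite inE.
suff : d \in O by rewrite inE.
have [conn _] := treeT; have /connectP[p] := conn (base d0) (base d).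
have : forall x, base x = base d0 -> x \in O by move=> x xd; apply: (around d0).
elim: p (base d0) => [|v p IHp] u uO /=; first by move=> _ /uO.
case/andP=> /existsP[e /and3P[eT /eqP eu /eqP ev]]; apply: IHp => x xv.
apply: (around (flip e)); first by rewrite ev.
by have := nosplit e; rewrite /split eT /= negbK => /eqP <-; apply: uO.
Qed.

End Visit.

(** * Divisors of oriented graphs *)

Section Allocation.
Variables (G : wgraph).
Implicit Types (U : {set vert G}) (ori : orientation G) (sigma : edge G -> int).

Definition load ori sigma (e : edge G) (b : bool) : int :=
  if ori e is Some c then
    if b == c then sigma e else (ewt e)%:Z - sigma e
  else 0.

Definition allocation ori sigma : divisor G :=
  \sum_(e : edge G)
     (if ori e is Some b then
        pt (endpt e b) *~ sigma e
          + pt (endpt e (~~ b)) *~ ((ewt e)%:Z - sigma e)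
      else 0).

Definition vertex_weights : divisor G := \sum_(v : vert G) pt v *~ (vwt v)%:Z.

Lemma pt_mulz (v w : vert G) (k : int) : (pt v *~ k) w = k *+ (w == v).
Proof.
have -> : (pt v *~ k) w = pt v w *~ k.
  by case: k => n; rewrite -?pmulrn ?NegzE ?mulrNz -?pmulrn ?ffunE ffunMnE ffunE.
by rewrite ffunE; case: (w == v); rewrite /= ?mulr1n ?mulr0n ?intz // mul0rz.
Qed.

Lemma mass_pt v k U : mass (pt v *~ k) U = k *+ (v \in U).
Proof.
rewrite /mass sum_ind (bigD1 v) //= pt_mulz eqxx big1 => [|w /negbTE wv].
  by rewrite /ind; case: (v \in U); rewrite /= ?mulr1n ?mulr0n ?mul1r ?mul0r addr0.
by rewrite pt_mulz wv mulr0.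
Qed.

Lemma massD (D D' : divisor G) U : mass (D + D') U = mass D U + mass D' U.
Proof. by rewrite /mass -big_split; apply: eq_bigr => v _; rewrite !ffunE. Qed.

Lemma mass_sum (I : finType) (F : I -> divisor G) U :
  mass (\sum_i F i) U = \sum_i mass (F i) U.
Proof.
rewrite /mass exchange_big /=; apply: eq_bigr => v _.
by rewrite sum_ffunE.
Qed.

Lemma deg_mass (D : divisor G) : deg D = mass D setT.
Proof. by apply: eq_bigl => v; rewrite inE. Qed.

Lemma mass1 (D : divisor G) v : mass D [set v] = D v.
Proof. by rewrite /mass big_set1. Qed.

Lemma mass_allocation ori sigma U : (forall e, ori e != None) ->
  mass (allocation ori sigma) U = carried (load ori sigma) U.
Proof.
move=> total; rewrite mass_sum; apply: eq_bigr => e _.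
rewrite /share /load; have := total e; case: (ori e) => // b _.
rewrite massD !mass_pt; case: b => /=.
  by case: (_ \in U); case: (_ \in U); rewrite /= ?mulr1n ?mulr0n; ring.
by case: (_ \in U); case: (_ \in U); rewrite /= ?mulr1n ?mulr0n; ring.
Qed.

Lemma deg_allocation ori sigma : (forall e, ori e != None) ->
  deg (allocation ori sigma) = total_weight G.
Proof.
move=> total; rewrite deg_mass mass_allocation //.
by apply: eq_bigr => e _; rewrite /share !inE.
Qed.

Lemma deg_vertex_weights : deg vertex_weights = \sum_(v : vert G) (vwt v)%:Z.
Proof.
rewrite deg_mass mass_sum; apply: eq_bigr => v _.
by rewrite mass_pt inE mulr1n.
Qed.

End Allocation.

(** * Tour divisors are orientable *)

Section TourOrientation.
Variables (G : wgraph) (rho : ribbon G) (d0 : dart G) (T : {set edge G}).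

(** The orientation of an edge is decided by the first of its two darts that
the tour meets, and is never changed afterwards. *)
Lemma tour_first n e b : (tour rho d0 T n).2 e = Some b ->
  exists j, let d := iter j (next_dart rho T) d0 in
  [/\ (j < n)%N, d.1 = e, b = (if e \in T then ~~ d.2 else d.2) &
      forall i, (i < j)%N -> (iter i (next_dart rho T) d0).1 <> e].
Proof.
elim: n => [|n IHn] /=; first by rewrite ffunE.
have keep : (tour rho d0 T n).2 e = Some b ->
  exists j, let d := iter j (next_dart rho T) d0 in
  [/\ (j < n.+1)%N, d.1 = e, b = (if e \in T then ~~ d.2 else d.2) &
      forall i, (i < j)%N -> (iter i (next_dart rho T) d0).1 <> e].
  by case/IHn=> j [jn *]; exists j; split=> //; apply: ltnW.
have := @tour_oriented G rho d0 T ^~ n.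
move: keep; have := tour_dart rho d0 T n; rewrite /tour_step.
case: (tour rho d0 T n) => d ori /= dE keep orn.
have first c : ori d.1 = None -> e = d.1 -> c = (if e \in T then ~~ d.2 else d.2) ->
    c = b ->
  exists j, let d := iter j (next_dart rho T) d0 in
  [/\ (j < n.+1)%N, d.1 = e, b = (if e \in T then ~~ d.2 else d.2) &
      forall i, (i < j)%N -> (iter i (next_dart rho T) d0).1 <> e].
  move=> none ed cE <-; exists n; rewrite -dE; split=> // i /orn + ie.
  by rewrite ie ed none.
case: ifP => dT /=; rewrite /orient; case on: (ori d.1) => [c|] //;
  rewrite ffunE; case: eqP => // ed [] cb; apply: (first _ on ed _ cb);
  by rewrite ed dT.
Qed.

Hypothesis treeT : spanning_tree T.

Lemma tour_orientation_total e : tour_orientation rho d0 T e != None.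
Proof.
have vis := tour_visits_all rho d0 treeT (e, true).
rewrite -[e]/((e, true).1) -(iter_findex vis); apply: tour_oriented.
by apply: leq_trans (findex_max vis) (max_card _).
Qed.

(** Just before the tour is in [U] for the first time it stands on a tree dart
[d'] outside [U] whose flip is in [U].  The first dart of this edge on the tour
is [d'] itself, since up to then the tour has stayed outside [U]; so the edge is
oriented along [d'], into [U]. *)
Lemma tour_enters (U : {set vert G}) : U != set0 -> base d0 \notin U ->
  exists e b, [/\ e \in T, tour_orientation rho d0 T e = Some b,
    endpt e b \in U & endpt e (~~ b) \notin U].
Proof.
case/set0Pn=> u uU d0U; set next := next_dart rho T.
have [d du|nod] := pickP [pred d : dart G | base d == u]; last first.
  have [conn _] := treeT; have /connectP[[|v p]] := conn u (base d0).
    by move=> _ ub; rewrite ub uU in d0U.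
  by case/andP=> /existsP[d /and3P[_ du _]]; have := nod d; rewrite /= du.
have : exists k, base (iter k next d0) \in U.
  exists (findex next d0 d); rewrite iter_findex ?(eqP du) //.
  exact: tour_visits_all.
case/ex_minnP=> [[|k]]; first by rewrite /= (negbTE d0U).
set d' := iter k next d0 => dU kmin.
have before i : (i <= k)%N -> base (iter i next d0) \notin U.
  by move=> ik; apply/negP => /kmin; rewrite ltnNge ik.
have d'T : d'.1 \in T.
  apply: contraNT (before k (leqnn k)) => d'T; move: dU.
  by rewrite /= -/d' {1}/next /next_dart (negbTE d'T) base_rot.
have fU : base (flip d') \in U.
  by move: dU; rewrite /= -/d' {1}/next /next_dart d'T base_rot.
have := tour_orientation_total d'.1.
case E: (tour_orientation rho d0 T d'.1) => [b|] // _.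
exists d'.1, b; rewrite E d'T.
have [j [_ je bE first]] := tour_first E.
have jk : (j <= k)%N by rewrite leqNgt; apply/negP => /first.
have jd : iter j next d0 = d'.
  have [<- //|fl] := same_edge je.
  by move: fU; rewrite fl flipK (negbTE (before j jk)).
move: bE; rewrite d'T -/next jd => ->; split=> //.
by rewrite negbK; exact: before k (leqnn k).
Qed.

(** Edges inside [U] give it their whole weight, other edges give a nonnegative
amount, and the edge of [tour_enters] gives at least one as its [sigma] is
positive. *)
Lemma tour_divisor_orientable sigma : sub_weighting T sigma ->
  orientable (base d0) (allocation (tour_orientation rho d0 T) sigma).
Proof.
case=> sigN sigT; set ori := tour_orientation _ _ _.
have total := tour_orientation_total.
split; first exact: deg_allocation.
move=> U U0; rewrite /slack mass_allocation // -sumrB.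
have loc e : 0 <= share (load ori sigma) e U - share (@unloaded G) e U.
  rewrite /share /unloaded /load; have := total e; rewrite -/ori.
  have := ewt_gt0 e.
  have : 0 <= sigma e <= (ewt e)%:Z.
    case: (boolP (e \in T)) => [/sigT /andP[s1 ->]|/sigN ->]; last by rewrite lexx.
    by rewrite andbT (le_trans _ s1).
  case: (ori e) => // -[] /=; case: (_ \in U); case: (_ \in U);
    rewrite /= ?mulr1n ?mulr0n; lia.
case: (boolP (base d0 \in U)) => [_|d0U] /=; first exact: sumr_ge0.
have [e [b [eT eo eb enb]]] := tour_enters U0 d0U.
rewrite (bigD1 e) //=; apply: ler_wpDr; first exact: sumr_ge0.
have /andP[s1 s2] := sigT e eT.
rewrite /share /unloaded /load eo; case: b eo eb enb => eo /= -> /negbTE->;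
  by rewrite /= ?mulr1n ?mulr0n; lia.
Qed.

End TourOrientation.

(** * Darts around a vertex, and forests *)

Section Around.
Variables (G : wgraph) (rho : ribbon G).
Implicit Types d x y : dart G.

Definition around d : seq (dart G) := traject rho d #|porbit rho d|.

Lemma mem_around d x : (x \in around d) = (base x == base d).
Proof. by rewrite -porbit_traject rotP inE. Qed.

Lemma around_uniq d : uniq (around d).
Proof. exact: uniq_traject_porbit. Qed.

Lemma size_around d : size (around d) = #|[set x | base x == base d]|.
Proof. by rewrite size_traject rotP. Qed.

Lemma around_cons d : exists s, around d = d :: s /\ fpath rho d s.
Proof.
have : (0 < #|porbit rho d|)%N by apply/card_gt0P; exists d; apply: porbit_id.
rewrite /around; case: #|_| => // n _; exists (traject rho (rho d) n).
by split=> //; apply: fpath_traject.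
Qed.

Lemma last_around x d : last x (around (rho d)) = d.
Proof.
have [s [E _]] := around_cons (rho d).
have := last_traject rho d #|porbit rho (rho d)|; rewrite -/(around (rho d)) E /=.
move=> ->; have -> : porbit rho (rho d) = porbit rho d by rewrite !rotP base_rot.
exact: iter_porbit.
Qed.

Lemma sub_path_belast (T : eqType) (e e' : rel T) (x : T) (p : seq T) :
  (forall u v, u \in belast x p -> e u v -> e' u v) -> path e x p -> path e' x p.
Proof.
elim: p x => //= y p IHp x sub /andP[exy ep].
rewrite sub ?mem_head //=; apply: IHp => // u v ub; apply: sub.
by rewrite inE ub orbT.
Qed.

End Around.

Section Forest.
Variable G : wgraph.
Implicit Types (A : {set edge G}) (W : {set vert G}).

Lemma adj_sym A : symmetric (adj A).
Proof.
suff imp u v : adj A u v -> adj A v u by move=> u v; apply/idP/idP; apply: imp.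
case/existsP=> d /and3P[dA du dv]; apply/existsP; exists (flip d).
by rewrite flipK dv du andbT; rewrite dA.
Qed.

(** A cycle through the new edge would visit its end outside [W] and leave it by
another edge, but all the other edges have both their ends in [W]. *)
Lemma acyclicU1 A W (d : dart G) : acyclic A ->
  (forall x : dart G, x.1 \in A -> base x \in W) ->
  base d \in W -> base (flip d) \notin W -> acyclic (d.1 |: A).
Proof.
move=> acA AW dW fW c cyc; apply/negP => /allP cA1.
have /negP[] := acA c cyc; apply/allP => z zc.
have := cA1 z zc; rewrite !inE => /orP[/eqP zd|] //.
have /and4P[_ cycle_c _ /uniq_map_inj inj] := cyc.
have only y : y \in c -> base y = base (flip d) \/ base (flip y) = base (flip d) ->
    y.1 = d.1.
  move=> yc end_y; have := cA1 y yc; rewrite !inE => /orP[/eqP //|yA].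
  case/negP: fW; case: end_y => <-; first exact: AW.
  exact: (AW (flip y)).
have [zE|zE] := same_edge (esym zd).
  have nc : next c z \in c by rewrite mem_next.
  have /eqP nb := next_cycle cycle_c zc.
  have nz : next c z = z.
    by apply: inj => //; rewrite zd; apply: only => //; left; rewrite -nb zE.
  by move: fW; rewrite -zE nb nz zE dW.
have pc : prev c z \in c by rewrite mem_prev.
have /eqP pb := prev_cycle cycle_c zc.
have pz : prev c z = z.
  by apply: inj => //; rewrite zd; apply: only => //; right; rewrite pb zE.
by move: fW; rewrite -zE -pb pz zE flipK dW.
Qed.

End Forest.

(** * The greedy tour of an orientable divisor *)

Section Greedy.
Variables (G : wgraph) (rho : ribbon G) (D : divisor G) (q : vert G).
Hypothesis degD : deg D = total_weight G.
Implicit Types (ori : orientation G) (sigma : edge G -> int).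
Implicit Types (A : {set edge G}) (W U M : {set vert G}) (L : seq (dart G)).

Definition residual ori sigma U := slack D (load ori sigma) U.

(** The second alternative is a set of zero slack around the base of [y] that
avoids the base of [x]: nothing can be taken away from that set, so a free edge
between the two vertices can be given entirely to the base of [x]. *)
Definition separated ori sigma (x y : dart G) : bool :=
  (base x == base y) ||
  [exists M : {set vert G},
     [&& residual ori sigma M == 0, base y \in M & base x \notin M]].

Lemma pairwise_same_base ori sigma v (s : seq (dart G)) :
  (forall x, x \in s -> base x = v) -> pairwise (separated ori sigma) s.
Proof.
elim: s => //= x s IHs same; apply/andP; split; last first.
  by apply: IHs => y ys; apply: same; rewrite inE ys orbT.
apply/allP => y ys; rewrite /separated !same ?eqxx ?mem_head //.
by rewrite inE ys orbT.
Qed.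

(** The state of the greedy tour: [L] is the list of the darts around visited
vertices that remain to be toured, the current one first, [A] is the tree built
so far and [W] its vertex set.  The field [pt_slack] is orientability for the
graph in which [W] is contracted to the root.  The field [pt_next] says that
touring [A] goes through [L] in order; new darts are only ever inserted just
behind the current one, so that the darts already toured are not affected. *)
Record partial_tour L ori sigma A W : Prop := PartialTour {
  pt_sigma : sub_weighting A sigma;
  pt_oriented : forall e, e \in A -> ori e != None;
  pt_slack : forall U, U != set0 -> ([disjoint U & W])%:R <= residual ori sigma U;
  pt_root : q \in W;
  pt_visited : forall d : dart G, d.1 \in A -> base d \in W;
  pt_conn : forall v, v \in W -> connect (adj A) q v;
  pt_acyclic : acyclic A;
  pt_free : forall d : dart G, base d \in W -> ori d.1 = None -> d \in L;
  pt_stack : forall d, d \in L -> base d \in W;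
  pt_uniq : uniq L;
  pt_sep : pairwise (separated ori sigma) L;
  pt_next : sorted (fun x y => next_dart rho A x == y) L
}.

Lemma load_ge0 ori sigma A : sub_weighting A sigma ->
  forall e b, 0 <= load ori sigma e b.
Proof.
case=> sN sA e b; rewrite /load; case: (ori e) => // c.
have : 0 <= sigma e <= (ewt e)%:Z.
  case: (boolP (e \in A)) => [/sA /andP[s1 ->]|/sN ->]; last by rewrite lexx.
  by rewrite andbT (le_trans _ s1).
by case: (b == c); lia.
Qed.

Lemma load_sum ori sigma e :
  load ori sigma e true + load ori sigma e false = (ewt e)%:Z *+ (ori e != None).
Proof. by rewrite /load; case: (ori e) => [[]|]; rewrite //=; ring. Qed.

Lemma residual_orient ori sigma sigma' e b U : ori e = None ->
  (forall e', e' != e -> sigma' e' = sigma e') ->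
  residual (orient e b ori) sigma' U = residual ori sigma U
    - (sigma' e *+ ((endpt e b \in U) && (endpt e (~~ b) \notin U))
       + ((ewt e)%:Z - sigma' e) *+ ((endpt e b \notin U) && (endpt e (~~ b) \in U))).
Proof.
move=> none same; rewrite /residual /slack /orient none -addrA -opprD.
congr (_ - _); rewrite /carried [LHS](bigD1 e) // [in RHS](bigD1 e) //=.
rewrite addrAC; congr (_ + _).
  rewrite /share /load none ffunE eqxx.
  by case: b; case: (_ \in U); case: (_ \in U); rewrite /= ?mulr1n ?mulr0n; ring.
apply: eq_bigr => e' ne; rewrite /share /load ffunE (negbTE ne).
by case: (ori e') => // c; rewrite same.
Qed.

Section State.
Variables (L : seq (dart G)) (ori : orientation G) (sigma : edge G -> int).
Variables (A : {set edge G}) (W : {set vert G}).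
Hypothesis st : partial_tour L ori sigma A W.
Notation res := (residual ori sigma).

Lemma residual_ge0 U : 0 <= res U.
Proof.
have [->|U0] := eqVneq U set0; last first.
  by apply: le_trans (pt_slack st U0); case: [disjoint _ & _].
rewrite /residual /slack /mass big_set0 /carried big1 ?subrr // => e _.
by rewrite /share !inE.
Qed.

Lemma free_notin_tree e : ori e = None -> e \notin A.
Proof. by move=> none; apply/negP => /(pt_oriented st); rewrite none. Qed.

(** Both the union and the intersection of [U] and [M] have nonnegative slack, so
submodularity leaves the whole weight of the free edge between them. *)
Lemma residual_exchange (d : dart G) U M : ori d.1 = None ->
  base d \in M -> base (flip d) \notin M ->
  base (flip d) \in U -> base d \notin U -> (ewt d.1)%:Z <= res U + res M.
Proof.
move=> none dM fM fU dU.
have := @slack_submodular G D (load ori sigma) U M (load_ge0 _ (pt_sigma st)).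
have le e : load ori sigma e true + load ori sigma e false <= (ewt e)%:Z.
  by rewrite load_sum; case: (_ != _).
move=> /(_ le d.1 (~~ d.2) fU fM); rewrite negbK => /(_ dM dU).
have := load_sum ori sigma d.1; rewrite none mulr0n.
have := residual_ge0 (U :|: M); have := residual_ge0 (U :&: M).
rewrite /residual; lia.
Qed.

End State.

(** When no dart remains, no free edge touches [W]; so [W] and its complement
share the slack zero of the whole vertex set, and the complement, whose slack
is positive if it is nonempty, is empty.  For the same reason all the slacks
then vanish, and those of singletons say that [D] is the allocation. *)
Lemma partial_tour_end ori sigma A W : partial_tour [::] ori sigma A W ->
  [/\ spanning_tree A, forall e, ori e != None & D = allocation ori sigma].
Proof.
move=> st; have noW e b : endpt e b \in W -> ori e != None.
  by move=> eW; apply/negP => /eqP none; have := pt_free st (d := (e, b)) eW none.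
have split U : (forall e, crosses e U -> ori e != None) ->
    residual ori sigma U + residual ori sigma (~: U) = 0.
  move=> orU; rewrite /residual slack_setC // /free_cut big1 // => e _.
  case: (boolP (crosses e U)) => // /orU eo.
  by have := load_sum ori sigma e; rewrite eo !mulr1n -addrA -opprD => ->; rewrite subrr.
have WT : W = setT.
  apply/eqP; rewrite -[W]setCK -setC0 (inj_eq (@setC_inj _)).
  apply/negPn/negP => CW0; have := pt_slack st CW0.
  rewrite disjoint_sym -subsets_disjoint subxx /=.
  have := split W; have := residual_ge0 st W.
  move=> W0 /(_ _)/wrap[e|]; last by lia.
  rewrite /crosses; case: (boolP (_ \in W)) => [/noW //|_].
  by case: (boolP (_ \in W)) => [/noW //|_].
have total e : ori e != None by apply: (noW e true); rewrite WT inE.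
split=> //.
- split; last exact: pt_acyclic st.
  have fromq v : connect (adj A) q v by apply: (pt_conn st); rewrite WT inE.
  move=> u v; apply: connect_trans (fromq v).
  by rewrite sym_connect_sym //; apply: adj_sym.
- apply/ffunP => v; rewrite -!mass1 mass_allocation //.
  have := split [set v] (fun e _ => total e).
  have := residual_ge0 st [set v]; have := residual_ge0 st (~: [set v]).
  rewrite /residual /slack; lia.
Qed.

Lemma partial_tour_skip d L ori sigma A W :
  partial_tour (d :: L) ori sigma A W -> ori d.1 != None ->
  partial_tour L ori sigma A W.
Proof.
case=> sg orA sl qW vis con acy free stk un sep nxt od; split=> //.
- move=> x xW none; have := free x xW none; rewrite inE => /orP[/eqP xd|//].
  by rewrite -xd none in od.
- by move=> x xL; apply: stk; rewrite inE xL orbT.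
- by case/andP: un.
- by case/andP: sep.
- exact: path_sorted nxt.
Qed.

(** The edge of [d] stays out of the tree and all its weight goes to the base of
[d]: by hypothesis the sets that have to pay for this can afford it. *)
Lemma partial_tour_delete d L ori sigma A W :
  partial_tour (d :: L) ori sigma A W -> ori d.1 = None ->
  (forall U, base d \in U -> base (flip d) \notin U ->
     (ewt d.1)%:Z <= residual ori sigma U) ->
  partial_tour L (orient d.1 d.2 ori) sigma A W.
Proof.
move=> st none big; have dA := free_notin_tree st none.
have resE U : residual (orient d.1 d.2 ori) sigma U = residual ori sigma U
    - (ewt d.1)%:Z *+ ((base d \in U) && (base (flip d) \notin U)).
  rewrite (@residual_orient ori sigma) // (proj1 (pt_sigma st) _ dA) subrr mul0rn.
  by rewrite addr0.
have ew := ewt_gt0 d.1.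
have dW : base d \in W by apply: (pt_stack st); apply: mem_head.
have oriE e : orient d.1 d.2 ori e = if e == d.1 then Some d.2 else ori e.
  by rewrite /orient none ffunE.
case: (st) => sg orA sl qW vis con acy free stk un sep nxt; split=> //.
- by move=> e /orA; rewrite oriE; case: ifP.
- move=> U U0; rewrite resE.
  case: (boolP (base d \in U)) => [dU|_]; last by rewrite subr0 sl.
  have := big U dU; have := sl U U0.
  case: (base _ \in U) => /=; rewrite ?subr0 // => _ /(_ isT).
  suff -> : [disjoint U & W] = false by rewrite mulr1n subr_ge0.
  by apply/pred0Pn; exists (base d); rewrite /= dU.
- move=> x xW; rewrite oriE; case: ifP => // /eqP xd /(free x xW).
  by rewrite inE => /orP[/eqP E|//]; rewrite E in xd.
- by move=> x xL; apply: stk; rewrite inE xL orbT.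
- by case/andP: un.
- move: sep => /= /andP[_]; apply: sub_pairwise => x y /orP[bxy|].
    by rewrite /separated bxy.
  case/existsP=> M /and3P[/eqP M0 yM xM]; apply/orP; right.
  apply/existsP; exists M; rewrite resE M0 yM xM !andbT.
  case: (boolP (_ && _)) => [/andP[dM fM]|_]; last by rewrite subr0.
  by have := big M dM fM; rewrite M0 leNgt ltz_nat ew.
- exact: path_sorted nxt.
Qed.


(** The edge of [d] enters the tree because [M] cannot afford its weight.  The
base [v] of [d] receives the slack [m] of the tightest set, the other end [w] the
rest.  Sets containing [w] but not [v] can afford their payment by exchange with
[M].  Were [w] already visited, the stack would contain the flip of [d] and
provide a set of zero slack containing [w] but not [v], contradicting this
inequality.  Afterwards [M] has zero slack, which separates [w] from the
vertices below it in the stack. *)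
Lemma partial_tour_contract d L ori sigma A W M m :
  partial_tour (d :: L) ori sigma A W -> ori d.1 = None ->
  base d \in M -> base (flip d) \notin M -> residual ori sigma M = m ->
  m < (ewt d.1)%:Z ->
  (forall U, base d \in U -> base (flip d) \notin U ->
     m <= residual ori sigma U) ->
  base (flip d) \notin W /\
  partial_tour (around rho (rho (flip d)) ++ L) (orient d.1 (~~ d.2) ori)
    (fun e => if e == d.1 then (ewt d.1)%:Z - m else sigma e)
    (d.1 |: A) (base (flip d) |: W).
Proof.
move=> st none dM fM resM mlt mmin; have dA := free_notin_tree st none.
set sigma1 := fun e => _; set ori1 := orient _ _ _.
have m0 : 0 <= m by rewrite -resM; apply: residual_ge0 st _.
have exch U : base (flip d) \in U -> base d \notin U ->
    (ewt d.1)%:Z - m <= residual ori sigma U.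
  move=> fU dU; have := residual_exchange st none dM fM fU dU; rewrite resM.
  by rewrite lerBlDr.
(* No set of zero slack contains the new vertex without the current one. *)
have notight U : base (flip d) \in U -> base d \notin U ->
    residual ori sigma U = 0 -> False.
  by move=> fU dU U0; have := exch U fU dU; rewrite U0 leNgt subr_gt0 mlt.
have resE U : residual ori1 sigma1 U = residual ori sigma U
    - (((ewt d.1)%:Z - m) *+ ((base (flip d) \in U) && (base d \notin U))
       + m *+ ((base (flip d) \notin U) && (base d \in U))).
  rewrite (@residual_orient ori sigma) // => [|e /negbTE ne]; last first.
    by rewrite /sigma1 ne.
  by rewrite /sigma1 eqxx negbK subKr.
have dW : base d \in W by apply: (pt_stack st); apply: mem_head.
have oriE e : ori1 e = if e == d.1 then Some (~~ d.2) else ori e.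
  by rewrite /ori1 /orient none ffunE.
have tight U : residual ori sigma U = 0 -> residual ori1 sigma1 U = 0.
  move=> U0; rewrite resE U0; case: (boolP (base (flip d) \in U)) => fU /=;
    case: (boolP (base d \in U)) => dU /=; rewrite ?mulr1n ?mulr0n ?addr0 ?subrr //.
    by case: (notight U fU dU U0).
  by have := mmin U dU fU; rewrite U0 => m_le0; rewrite (@le_anti _ _ m 0) ?m_le0 ?m0 // addr0 subrr.
case: (st) => sg orA sl qW vis con acy free stk un sep nxt.
have fW : base (flip d) \notin W.
  apply/negP => fW; have := free _ fW none; rewrite inE (negbTE (flip_neq d)) /=.
  move=> fL; move: sep => /= /andP[/allP/(_ _ fL) + _].
  case/orP=> [/eqP E|/existsP[M' /and3P[/eqP M0 fM' dM']]].
    by rewrite -E dM in fM.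
  exact: notight M' fM' dM' M0.
split=> //.
have dL : d \notin L by move: un => /= /andP[].
have stkL x : x \in L -> base x \in W by move=> xL; apply: stk; rewrite inE xL orbT.
have fL : flip d \notin L by apply/negP => /stkL; rewrite (negbTE fW).
have bA x : (x \in around rho (rho (flip d))) = (base x == base (flip d)).
  by rewrite mem_around base_rot.
have bW x : x \in around rho (rho (flip d)) -> base x \notin W.
  by rewrite bA => /eqP ->.
split.
- split=> e; rewrite !inE ?negb_or /sigma1.
    by case/andP=> /negbTE-> /(proj1 sg).
  case: eqP => [-> _|_ /= /(proj2 sg) //]; rewrite gerBl m0 andbT.
  by rewrite lerBrDr addrC lezD1.
- by move=> e; rewrite oriE !inE; case: eqP => //= _ /orA.
- move=> U U0; rewrite resE.
  have disj : [disjoint U & base (flip d) |: W]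
            = (base (flip d) \notin U) && [disjoint U & W].
    by rewrite -!setI_eq0 setIUr setU_eq0 setIC setI_eq0 disjoints1.
  have := sl U U0; have := residual_ge0 st U; rewrite disj.
  have dis : base d \in U -> [disjoint U & W] = false.
    by move=> dU; apply/pred0Pn; exists (base d); rewrite /= dU.
  case: (boolP (base (flip d) \in U)) => fU /=;
    case: (boolP (base d \in U)) => dU /=; rewrite ?mulr1n ?mulr0n ?addr0 ?add0r ?subr0 //.
    by move=> _ _; rewrite subr_ge0; apply: exch.
  by move=> _ _; rewrite dis // subr_ge0; apply: mmin.
- by rewrite inE qW orbT.
- move=> x; rewrite !inE => /orP[/eqP/esym/same_edge[]->|/vis ->]; last by rewrite orbT.
    by rewrite dW orbT.
  by rewrite eqxx.
- have subA : subrel (connect (adj A)) (connect (adj (d.1 |: A))).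
    apply: connect_sub => u v /existsP[x /and3P[xA ux vx]].
    by apply/connect1/existsP; exists x; rewrite inE xA orbT ux vx.
  have conW v : v \in W -> connect (adj (d.1 |: A)) q v by move/con/subA.
  move=> v; rewrite !inE => /orP[/eqP ->|]; last exact: conW.
  apply: connect_trans (conW _ dW) _; apply/connect1/existsP; exists d.
  by rewrite !inE !eqxx.
- exact: (@acyclicU1 G A W).
- move=> x; rewrite !inE oriE mem_cat bA => xW.
  case: ifP => // /eqP xd none'; case/orP: xW => [->//|xW].
  have := free x xW none'; rewrite inE => /orP[/eqP E|->]; last by rewrite orbT.
  by rewrite E in xd.
- by move=> x; rewrite mem_cat bA !inE => /orP[->//|/stkL ->]; rewrite orbT.
- rewrite cat_uniq around_uniq; apply/and3P; split=> //; last by case/andP: un.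
  by apply/hasPn => x /stkL xW; apply/negP => /bW; rewrite xW.
- rewrite pairwise_cat; apply/and3P; split.
  + apply/allrelP => x y; rewrite bA => /eqP xf yL.
    apply/orP; right; apply/existsP.
    have [yd|nyd] := eqVneq (base y) (base d).
      exists M; rewrite xf yd dM fM !andbT resE resM (negbTE fM) dM.
      by rewrite /= add0r mulr1n subrr.
    move: sep => /= /andP[/allP/(_ _ yL) + _].
    rewrite /separated eq_sym (negbTE nyd) /= => /existsP[M' /and3P[/eqP M0 yM dM']].
    exists M'; rewrite tight // eqxx yM xf /=.
    by apply/negP => fM'; exact: notight M' fM' dM' M0.
  + apply: (@pairwise_same_base _ _ (base (flip d))) => x.
    by rewrite bA => /eqP.
  + move: sep => /= /andP[_]; apply: sub_pairwise => x y /orP[bxy|].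
      by rewrite /separated bxy.
    case/existsP=> M' /and3P[/eqP M0 yM xM]; apply/orP; right.
    by apply/existsP; exists M'; rewrite tight // eqxx yM xM.
- have nextE x : x != d -> x != flip d ->
      next_dart rho (d.1 |: A) x = next_dart rho A x.
    move=> xd xf; rewrite /next_dart !inE.
    by case: eqP => // /esym/same_edge[] E; rewrite E eqxx in xd xf.
  have [s [sE spath]] := around_cons rho (rho (flip d)).
  have lastE := last_around rho d (flip d); rewrite sE /= in lastE.
  rewrite sE /= cat_path lastE; apply/andP; split.
    move: spath; apply: sub_path_belast => x y xs /= /eqP <-.
    have := around_uniq rho (rho (flip d)); rewrite sE lastI rcons_uniq lastE.
    case/andP=> fs _.
    have xin : x \in around rho (rho (flip d)).
      by rewrite sE lastI mem_rcons inE xs orbT.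
    have xW := bW x xin.
    have xd : x != d by apply: contraNneq xW => ->.
    have xf : x != flip d by apply/eqP => xE; move: fs; rewrite -{1}xE xs.
    rewrite nextE // /next_dart; case: ifP => // xA.
    by case/negP: xW; apply: vis.
  (* Back from the new vertex, the tour resumes where it would have gone on if
     d had not been a tree dart. *)
  move: nxt dL fL => /=; case: (L) => //= y p /andP[/eqP dy yp] dL fL.
  apply/andP; split.
    by rewrite /next_dart !inE eqxx /= flipK -dy /next_dart (negbTE dA).
  apply: sub_path_belast yp => u v ub /eqP <-; rewrite nextE //.
    by apply: contraNneq dL => <-; rewrite mem_belast.
  by apply: contraNneq fL => <-; rewrite mem_belast.
Qed.

(** Each step removes one dart from those not yet toured, i.e. from the stack or
from around an unvisited vertex.  The final tree agrees with the current one on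
the edges already oriented, so touring the final tree retraces the greedy tour;
when [L] is empty nothing is left to tour, and the dart does not matter. *)
Lemma partial_tour_complete k L ori sigma A W :
  (#|[set d : dart G | base d \notin W]| + size L <= k)%N ->
  partial_tour L ori sigma A W ->
  exists T sigma' ori' n,
    [/\ spanning_tree T, sub_weighting T sigma',
        forall e, ori e != None -> (e \in T) = (e \in A),
        (forall e, ori' e != None) /\ D = allocation ori' sigma'
      & forall x, head x L = x -> (iter n (tour_step rho T) (x, ori)).2 = ori'].
Proof.
elim: k L ori sigma A W => [|k IHk] [|d L] ori sigma A W sz st;
  try by have [tA tot DE] := partial_tour_end st;
         exists A, sigma, ori, 0; split=> //; apply: pt_sigma st.
  by rewrite addnS in sz.
have step (L1 : seq (dart G)) ori1 sigma1 A1 W1 :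
    (#|[set x : dart G | base x \notin W1]| + size L1 <= k)%N ->
    partial_tour L1 ori1 sigma1 A1 W1 ->
    (forall e, ori e != None -> ori1 e != None /\ (e \in A1) = (e \in A)) ->
    ori1 d.1 != None ->
    ori1 = orient d.1 (if d.1 \in A1 then ~~ d.2 else d.2) ori ->
    (forall x, head x L1 = next_dart rho A1 d \/ L1 = [::]) ->
  exists T sigma' ori' n,
    [/\ spanning_tree T, sub_weighting T sigma',
        forall e, ori e != None -> (e \in T) = (e \in A),
        (forall e, ori' e != None) /\ D = allocation ori' sigma'
      & forall x, head x (d :: L) = x ->
          (iter n (tour_step rho T) (x, ori)).2 = ori'].
  move=> sz1 st1 old od oE hd.
  have [T [sigma' [ori' [n [tT wT TA1 fin walk]]]]] := IHk _ _ _ _ _ sz1 st1.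
  exists T, sigma', ori', n.+1; split=> //.
    by move=> e /old[eo <-]; apply: TA1.
  move=> x <- /=; rewrite -iterS iterSr.
  have -> : tour_step rho T (d, ori) = (next_dart rho A1 d, ori1).
    by rewrite /tour_step /next_dart TA1 // oE; case: ifP.
  by apply: walk; case: (hd (next_dart rho A1 d)) => ->.
have nxtL : forall x, head x L = next_dart rho A d \/ L = [::].
  by move=> x; case: L st {sz step} => [|y L] st; [right|left; case/andP: (pt_next st) => /eqP].
have szL : (#|[set x : dart G | base x \notin W]| + size L <= k)%N.
  by move: sz; rewrite /= addnS.
have [od|] := boolP (ori d.1 != None).
  apply: (step _ _ _ _ _ szL (partial_tour_skip st od)) => //.
  by rewrite /orient; case: (ori d.1) od.
rewrite negbK => /eqP none; have dA := free_notin_tree st none.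
have oE b e : ori e != None -> orient d.1 b ori e != None.
  by rewrite /orient none ffunE; case: ifP.
have od b : orient d.1 b ori d.1 != None.
  by rewrite /orient none ffunE eqxx.
have [big|] := boolP [forall U : {set vert G},
    (base d \in U) && (base (flip d) \notin U) ==>
      ((ewt d.1)%:Z <= residual ori sigma U)].
  have st1 : partial_tour L (orient d.1 d.2 ori) sigma A W.
    apply: partial_tour_delete => // U dU fU.
    by have /forallP/(_ U) := big; rewrite dU fU.
  apply: (step _ _ _ _ _ szL st1) => //; last by rewrite (negbTE dA).
  by move=> e eo; split=> //; apply: oE.
case/forallPn=> U0; rewrite negb_imply -ltNge => /andP[U0P U0lt].
(* The tightest set separating the current vertex from the other end. *)
pose P := [pred U : {set vert G} | (base d \in U) && (base (flip d) \notin U)].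
have [M /andP[dM fM] Mmin] := @arg_minP _ _ _ U0 P (residual ori sigma) U0P.
have [||fW st1] := partial_tour_contract st none dM fM erefl.
- exact: le_lt_trans (Mmin _ U0P) U0lt.
- by move=> U dU fU; apply: Mmin; rewrite /P /= dU fU.
apply: (step _ _ _ _ _ _ st1) => //.
- rewrite size_cat size_around base_rot addnA.
  apply: leq_trans szL; rewrite leq_add2r -cardsUI.
  rewrite [X in (_ + #|pred_of_set X|)%N](_ : _ = set0) ?cards0 ?addn0.
    apply/subset_leq_card/subsetP => x; rewrite !inE.
    by case/orP=> [|/eqP ->//]; rewrite negb_or => /andP[].
  by apply/setP => x; rewrite !inE negb_or; case: eqP => _; rewrite ?andbF.
- move=> e eo; split; first exact: oE.
  by rewrite !inE; case: eqP => // ed; case/eqP: eo; rewrite ed.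
- by rewrite !inE eqxx.
- move=> x; left; have [s [-> _]] := around_cons rho (rho (flip d)).
  by rewrite /= /next_dart !inE eqxx.
Qed.

End Greedy.

(** * Tour divisors as class representatives *)

Section Classes.
Variables (G : wgraph) (rho : ribbon G) (d0 : dart G).

(** Run the greedy tour from the state in which only the root is visited: there
[pt_slack] is orientability. *)
Lemma orientable_tour_divisor (D : divisor G) : orientable (base d0) D ->
  exists (T : {set edge G}) sigma, [/\ spanning_tree T, sub_weighting T sigma
     & D = allocation (tour_orientation rho d0 T) sigma].
Proof.
case=> degD oD.
pose ori0 : orientation G := [ffun=> None].
pose sigma0 (e : edge G) : int := (ewt e)%:Z.
have st : partial_tour rho D (base d0) (around rho d0) ori0 sigma0 set0 [set base d0].
  split.
  - by split=> e; rewrite inE.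
  - by move=> e; rewrite inE.
  - move=> U U0; rewrite disjoint_sym disjoints1.
    suff -> : residual D ori0 sigma0 U = slack D (@unloaded G) U by apply: oD.
    congr (_ - _); apply: eq_bigr => e _.
    by rewrite /share /load /unloaded ffunE.
  - by rewrite inE.
  - by move=> d; rewrite in_set0.
  - by move=> v; rewrite inE => /eqP ->; apply: connect0.
  - by rewrite /acyclic => -[|d c] //= _; rewrite inE.
  - by move=> d; rewrite inE mem_around.
  - by move=> d; rewrite inE mem_around.
  - exact: around_uniq.
  - by apply: (@pairwise_same_base _ _ _ _ (base d0)) => x; rewrite mem_around => /eqP.
  - have [s [-> /=]] := around_cons rho d0; apply: sub_path => x y.
    by rewrite /= /next_dart inE.
have [T [sigma [ori [n [tT wT _ [tot DE] walk]]]]] :=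
  partial_tour_complete degD (leqnn _) st.
exists T, sigma; split=> //.
have tourE : (tour rho d0 T n).2 = ori.
  by apply: walk; have [s [-> _]] := around_cons rho d0.
have stable m : (tour rho d0 T (m + n)).2 = ori.
  elim: m => // m IHm; rewrite addSn; have [b ->] := tour_orientS rho d0 T (m + n).
  by rewrite IHm /orient; case: (ori _) (tot (iter (m + n) (next_dart rho T) d0).1).
by rewrite DE -(stable #|{: dart G}|) tour_stable // leq_addr.
Qed.

Lemma laplacianB (f g : vert G -> int) :
  laplacian f - laplacian g = laplacian (fun v => f v - g v).
Proof.
apply/ffunP => v; rewrite !ffunE -sumrB; apply: eq_bigr => d _; ring.
Qed.

Lemma balancedB (D D' : divisor G) : balanced D -> balanced D' -> balanced (D - D').
Proof. by move=> bD bD' v; rewrite !ffunE; apply: rpredB; [exact: bD | exact: bD']. Qed.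

Lemma laplacian_balanced (f : vert G -> int) : pleasant G -> balanced (laplacian f).
Proof.
move=> pl v; rewrite ffunE; apply: rpred_sum => d /eqP bd.
by apply: dvdz_mulr; rewrite dvdzE /= -bd; apply: pl.
Qed.

End Classes.

Theorem theorem3p2 (G : wgraph) (rho : ribbon G) (q : vert G) (d0 : dart G)
    (G_connected : connected [set: edge G]) (G_pleasant : pleasant G)
    (d0_at_q : base d0 = q) :
  coset_representatives
    (fun D : divisor G => exists (T : {set edge G}) (sigma : edge G -> int),
       [/\ spanning_tree T, sub_weighting T sigma
         & D = tour_divisor rho d0 T sigma])
    (Div_deg (genus G - 1))
  /\
  coset_representatives
    (fun D : divisor G => exists (T : {set edge G}) (sigma : edge G -> int),
       [/\ spanning_tree T, balanced_sub_weighting rho d0 T sigma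
         & D = tour_divisor rho d0 T sigma])
    (Div_b_deg (genus G - 1)).
Proof.
pose S (D : divisor G) := exists (T : {set edge G}) (sigma : edge G -> int),
  [/\ spanning_tree T, sub_weighting T sigma & D = tour_divisor rho d0 T sigma].
have SE D : S D <-> orientable q (D + vertex_weights G).
  rewrite -d0_at_q; split=> [[T [sigma [tT wT ->]]]|].
    by rewrite subrK; apply: tour_divisor_orientable.
  case/(orientable_tour_divisor rho)=> T [sigma [tT wT DE]]; exists T, sigma; split=> //.
  by rewrite -[LHS](addrK (vertex_weights G)) DE.
have degE (D : divisor G) :
    deg D = genus G - 1 <-> deg (D + vertex_weights G) = total_weight G.
  rewrite -[vertex_weights G]opprK degB -[- vertex_weights G]sub0r degB.
  rewrite deg_vertex_weights /genus -/(total_weight G).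
  have -> : deg (0 : divisor G) = 0 by rewrite /deg big1 // => v _; rewrite ffunE.
  by split; lia.
have Sdeg D : S D -> deg D = genus G - 1 by case/SE => + _; rewrite degE.
have exS D : deg D = genus G - 1 -> exists f, S (D - laplacian f).
  case/degE/(equiv_orientable q G_connected) => f fP; exists f; apply/SE.
  by rewrite addrAC.
have uniqS D1 D2 : S D1 -> S D2 -> Prin (D1 - D2) -> D1 = D2.
  move=> /SE o1 /SE o2 [f fE]; apply: (addIr (vertex_weights G)).
  by apply: orientable_unique o1 o2 _; exists f; rewrite opprD addrACA subrr addr0.
have Sb D : (exists (T : {set edge G}) (sigma : edge G -> int),
       [/\ spanning_tree T, balanced_sub_weighting rho d0 T sigma
         & D = tour_divisor rho d0 T sigma]) <-> S D /\ balanced D.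
  split=> [[T [sigma [tT [wT bT] ->]]]|[[T [sigma [tT wT DE]]] bD]].
    by split=> //; exists T, sigma.
  by exists T, sigma; split=> //; split=> //; rewrite -DE.
have reps D : deg D = genus G - 1 ->
  exists f, S (D - laplacian f) /\
    forall D', S D' -> Prin (D - D') -> D - laplacian f = D'.
  move=> /exS [f fS]; exists f; split=> // D' D'S [f' f'E]; apply: uniqS => //.
  exists (fun v => f' v - f v); rewrite -laplacianB -f'E.
  by rewrite addrAC.
split; split.
- exact: Sdeg.
- move=> D /reps[f [fS fU]]; exists (D - laplacian f); split.
    by split=> //; exists f; rewrite subKr.
  by move=> D' [D'S D'P]; apply: fU.
- by move=> D /Sb[/Sdeg].
- move=> D [/reps[f [fS fU]] bD]; exists (D - laplacian f); split.
    split; last by exists f; rewrite subKr.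
    by apply/Sb; split=> //; apply: balancedB => //; apply: laplacian_balanced.
  by move=> D' [/Sb[D'S _] D'P]; apply: fU.
Qed.
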